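(* For a positive integer $n$ whose decimal expansion does not end in $0$ or $5$, let $\tau(n)$ be the least number of Choix de Bruxelles operations needed to transform $1$ into $n$. Then there exists $N$ such that for all $n \ge N$ whose decimal expansion does not end in $0$ or $5$, $$\log_{10} n + 5 < \tau(n) \le 12 \log_{10} n.$$
   Context: The Choix de Bruxelles operation: given a positive integer $n$ with decimal expansion $d_1 d_2 \ldots d_k$, choose indices $1 \le p \le q \le k$ with $d_p \neq 0$, let $s$ be the number with decimal representation $d_p d_{p+1}\ldots d_q$, and replace this substring in situ by the decimal expansion of $2s$, or, if $s$ is even, by the decimal expansion of $s/2$. One may also leave $n$ unchanged (empty substring). Every positive integer not ending in $0$ or $5$ can be reached from $1$ by finitely many such operations, so $\tau(n)$ is well defined. *)

(* Defs.v *)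
From mathcomp Require Import all_boot all_order all_algebra.
From mathcomp Require Import classical_sets reals exp.

Set Implicit Arguments.
Unset Strict Implicit.
Unset Printing Implicit Defensive.

(* Most significant digit first; [digits 0 = [:: 0]]. *)
Definition digits (n : nat) : seq nat :=
  [seq n %/ 10 ^ i %% 10 | i <- rev (iota 0 (trunc_log 10 n).+1)].

Definition value (ds : seq nat) : nat := foldl (fun v d => v * 10 + d) 0 ds.

(* The chosen substring d_p ... d_q is [s]; [head 0 s != 0] says both that it
   is nonempty and that d_p is nonzero. *)
Inductive choix (n : nat) : nat -> Prop :=
| choix_id : choix n n
| choix_double (u s v : seq nat) :
    digits n = u ++ s ++ v -> head 0 s != 0 ->
    choix n (value (u ++ digits (2 * value s) ++ v))
| choix_halve (u s v : seq nat) :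
    digits n = u ++ s ++ v -> head 0 s != 0 -> 2 %| value s ->
    choix n (value (u ++ digits (value s %/ 2) ++ v)).

Definition reaches_in (t m n : nat) : Prop :=
  exists c : nat -> nat,
    [/\ c 0 = m, c t = n & forall i, i < t -> choix (c i) (c i.+1)].

Definition least_ops (n t : nat) : Prop :=
  reaches_in t 1 n /\ forall t', reaches_in t' 1 n -> t <= t'.

(* The default 0 is returned when [n] is not reachable from 1. *)
Definition tau (n : nat) : nat := xget 0 [set t | least_ops n t]%classic.

Definition log10 (R : realType) (x : R) : R := (ln x / ln 10)%R.

(* Main.v *)
(** Let [n] have [k + 1] digits, so that [k <= log10 n < k + 1].

    Upper bound.  Let the seed of a number be 5 if 5 divides it and 1 otherwise.
    Every two-digit number is reached from its seed in 12 operations that never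
    produce more than three digits.  If [n = 10 m + d], unfold the seed of [n]
    into the two digits [r d], where [r] is the seed of [m], and go on with [r]
    in front of the untouched [d].

    Lower bound.  An operation lengthens the string by at most one digit, so a
    string of [l] digits is not reached from 1 in fewer than [l - 1] operations.
    The sequences of operations that never exceed this bound by more than 5 die
    out: none of them has 10 operations. *)

Require Import Defs.
From mathcomp Require Import all_boot all_order all_algebra.
From mathcomp Require Import reals.
From mathcomp Require Import boolp classical_sets exp.
From mathcomp Require Import zify.

Set Implicit Arguments.
Unset Strict Implicit.
Unset Printing Implicit Defensive.

(** * Decimal strings *)

Definition numeral (s : seq nat) := all (gtn 10) s && (head 0 s != 0).

Lemma value_rcons s d : value (rcons s d) = value s * 10 + d.
Proof. by rewrite /value foldl_rcons. Qed.

Lemma value_cons d s : value (d :: s) = d * 10 ^ size s + value s.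
Proof.
elim/last_ind: s => [|s e IH]; first by rewrite muln1 addn0.
by rewrite -rcons_cons !value_rcons IH size_rcons expnSr mulnDl mulnA addnA.
Qed.

Lemma odd_value s : odd (value s) = odd (last 0 s).
Proof.
by elim/last_ind: s => // s d _; rewrite value_rcons last_rcons oddD oddM andbF.
Qed.

Lemma numeral_cat s t :
  s != [::] -> numeral (s ++ t) = numeral s && all (gtn 10) t.
Proof. by case: s => // d s _; rewrite /numeral all_cat andbAC. Qed.

Lemma numeral_rcons s d :
  s != [::] -> numeral (rcons s d) = numeral s && (d < 10).
Proof. by move=> s0; rewrite -cats1 numeral_cat //= andbT. Qed.

Lemma numeral_infix u s v : numeral (u ++ s ++ v) -> head 0 s != 0 -> numeral s.
Proof. by rewrite /numeral !all_cat => /andP[/and3P[_ -> _] _] ->. Qed.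

Lemma numeral_subst u s v t :
  numeral (u ++ s ++ v) -> numeral t -> numeral (u ++ t ++ v).
Proof.
rewrite /numeral !all_cat => /andP[/and3P[-> _ ->] h] /andP[-> h'] /=.
by case: u h => // _; case: t h'.
Qed.

Lemma value_gt0 s : numeral s -> 0 < value s.
Proof.
case: s => // d s /andP[_ d0].
by rewrite value_cons ltn_addr // muln_gt0 expn_gt0 lt0n d0.
Qed.

Lemma size_digits n : size (digits n) = (trunc_log 10 n).+1.
Proof. by rewrite size_map size_rev size_iota. Qed.

Lemma digits_small n : n < 10 -> digits n = [:: n].
Proof.
move=> n10; have tl0 : trunc_log 10 n = 0.
  by apply/eqP; rewrite trunc_log_eq0 /=.
by rewrite /digits tl0 /= divn1 modn_small.
Qed.

Lemma trunc_log10_rcons n d :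
  0 < n -> d < 10 -> trunc_log 10 (n * 10 + d) = (trunc_log 10 n).+1.
Proof.
move=> n0 d10; apply: trunc_log_eq => //.
have /andP[lo hi] := trunc_log_bounds (isT : 1 < 10) n0.
by rewrite !expnS in hi *; apply/andP; split; lia.
Qed.

Lemma digits_rcons n d :
  0 < n -> d < 10 -> digits (n * 10 + d) = rcons (digits n) d.
Proof.
move=> n0 d10; rewrite /digits trunc_log10_rcons //.
rewrite -[iota 0 _.+2]/(0 :: iota (1 + 0) _.+1) iotaDl rev_cons map_rcons.
rewrite -map_rev -map_comp; congr rcons; last first.
  by rewrite /= divn1 modnMDl modn_small.
apply: eq_map => i /=; rewrite expnD expn1 divnMA; congr (_ %/ _ %% _).
by rewrite divnMDl // divn_small // addn0.
Qed.

Lemma decimal_ind (P : nat -> Prop) :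
  (forall n, 0 < n < 10 -> P n) ->
  (forall n d, 0 < n -> d < 10 -> P n -> P (n * 10 + d)) ->
  forall n, 0 < n -> P n.
Proof.
move=> Psmall Prcons; elim/ltn_ind=> n IH n0.
have [n10|n10] := ltnP n 10; first by apply: Psmall; rewrite n0.
have q0 : 0 < n %/ 10 by rewrite divn_gt0.
rewrite (divn_eq n 10); apply: Prcons; rewrite ?ltn_pmod //; apply: IH => //.
by rewrite ltn_Pdiv.
Qed.

Lemma digits_neq_nil n : digits n != [::].
Proof. by rewrite -size_eq0 size_digits. Qed.

Lemma numeral_digits n : 0 < n -> numeral (digits n).
Proof.
move: n; apply: decimal_ind => [n /andP[n0 n10]|n d n0 d10 IH].
  by rewrite digits_small // /numeral /= andbT n10 -lt0n.
by rewrite digits_rcons // numeral_rcons ?digits_neq_nil // IH.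
Qed.

Lemma last_digits n : last 0 (digits n) = n %% 10.
Proof.
have [n10|n10] := ltnP n 10; first by rewrite digits_small // modn_small.
by rewrite {1}(divn_eq n 10) digits_rcons ?divn_gt0 ?ltn_pmod // last_rcons.
Qed.

Lemma value_digits n : value (digits n) = n.
Proof.
have [->|] := posnP n; first by rewrite digits_small.
move: n; apply: decimal_ind => [n /andP[n0 n10]|n d n0 d10 IH].
  by rewrite digits_small.
by rewrite digits_rcons // value_rcons IH.
Qed.

Lemma digits_value s : numeral s -> digits (value s) = s.
Proof.
elim/last_ind: s => // s d IH ns; rewrite value_rcons.
have d10 : d < 10 by move: ns; rewrite /numeral all_rcons => /andP[/andP[]].
have [->|s0] := eqVneq s [::]; first exact: digits_small.
move: ns; rewrite numeral_rcons // => /andP[ns _].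
by rewrite digits_rcons ?IH ?value_gt0.
Qed.

(** * The operations on strings *)

(* The carry out of the leading digit comes first. *)
Fixpoint scale_carry (m : nat) (s : seq nat) : nat * seq nat :=
  if s is d :: s' then
    let: (c, t) := scale_carry m s' in
    ((m * d + c) %/ 10, (m * d + c) %% 10 :: t)
  else (0, [::]).

Definition scale (m : nat) (s : seq nat) : seq nat :=
  let: (c, t) := scale_carry m s in if c == 0 then t else c :: t.

Lemma size_scale_carry m s : size (scale_carry m s).2 = size s.
Proof. by elim: s => //= d s; case: scale_carry => c t /= ->. Qed.

Lemma value_scale_carry m s :
  (scale_carry m s).1 * 10 ^ size s + value (scale_carry m s).2 = m * value s.
Proof.
elim: s => [|d s]; first by rewrite muln0.
have := size_scale_carry m s; rewrite /=; case: scale_carry => c t /= st IH.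
rewrite !value_cons st expnS mulnDr -IH mulnA addnA -mulnDl -divn_eq.
by rewrite mulnDl !mulnA addnA.
Qed.

Lemma scale_carry_bounds m s : 0 < m -> all (gtn 10) s ->
  (scale_carry m s).1 < m /\ all (gtn 10) (scale_carry m s).2.
Proof.
move=> m0; elim: s => //= d s IH /andP[d10 /IH].
case: scale_carry => c t /= [cm ->]; rewrite ltn_pmod // ltn_divLR //.
have md : m * d <= m * 9 by rewrite leq_mul2l orbC (d10 : d <= 9).
by split=> //; lia.
Qed.

Lemma value_scale m s : value (scale m s) = m * value s.
Proof.
rewrite -value_scale_carry /scale; have := size_scale_carry m s.
by case: scale_carry => c t /= <-; case: eqP => [->|_]; rewrite ?value_cons.
Qed.

Lemma size_scale m s : size (scale m s) <= (size s).+1.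
Proof.
rewrite -(size_scale_carry m s) /scale; case: scale_carry => c t /=.
by case: ifP.
Qed.

Lemma numeral_scale m s : 0 < m <= 10 -> numeral s -> numeral (scale m s).
Proof.
move=> /andP[m0 m10] /andP[s10 h0]; rewrite /scale.
have := scale_carry_bounds m0 s10.
case carry_s: scale_carry => [c t] /= [cm t10]; rewrite /numeral.
case: ifPn => [c0|c0] /=; last by rewrite t10 c0 (leq_trans cm).
rewrite t10; case: s h0 {s10} carry_s => //= d s d0.
case: scale_carry => c' t' [carry_d <-] /=.
rewrite modn_small; last by rewrite ltnNge -divn_gt0 // carry_d -eqn0Ngt.
by rewrite -lt0n addn_gt0 muln_gt0 m0 lt0n d0.
Qed.

Lemma digits_scale m s :
  0 < m <= 10 -> numeral s -> digits (m * value s) = scale m s.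
Proof. by move=> m10 ns; rewrite -value_scale digits_value ?numeral_scale. Qed.

(* [value s %/ 2] is [5 * value s] without its final zero. *)
Definition halve (s : seq nat) : seq nat :=
  let t := scale 5 s in take (size t).-1 t.

Lemma digits_halve s :
  numeral s -> 2 %| value s -> digits (value s %/ 2) = halve s.
Proof.
move=> ns s2; have s0 := value_gt0 ns.
have scale5 : scale 5 s = rcons (digits (value s %/ 2)) 0.
  have h0 : 0 < value s %/ 2 by rewrite divn_gt0 // dvdn_leq.
  by rewrite -digits_scale // -digits_rcons // addn0; congr digits; lia.
by rewrite /halve scale5 size_rcons /= -cats1 take_size_cat.
Qed.

Lemma size_halve s : size (halve s) <= size s.
Proof.
by rewrite /halve size_takel ?leq_pred // -subn1 leq_subLR size_scale.
Qed.

Definition replacements (s : seq nat) : seq (seq nat) :=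
  if head 0 s == 0 then [::]
  else scale 2 s :: (if odd (last 0 s) then [::] else [:: halve s]).

Lemma replacementsP s t : numeral s ->
  reflect
    (t = digits (2 * value s) \/ 2 %| value s /\ t = digits (value s %/ 2))
    (t \in replacements s).
Proof.
move=> ns; have /andP[_ /negPf h0] := ns.
rewrite /replacements h0 inE digits_scale // dvdn2 odd_value.
case: ifPn => os; rewrite ?inE.
  by rewrite orbF; apply: (iffP eqP) => [->|[|[]]] //; left.
rewrite digits_halve ?dvdn2 ?odd_value //.
apply: (iffP orP) => [[] /eqP|[->|[_ ->]]]; by [left | right].
Qed.

Lemma replacements_head s t : t \in replacements s -> head 0 s != 0.
Proof. by rewrite /replacements; case: eqP. Qed.

Lemma size_replacements s t : t \in replacements s -> size t <= (size s).+1.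
Proof.
rewrite /replacements; case: ifP => // _; rewrite inE => /orP[/eqP->|].
  exact: size_scale.
by case: ifP => // _; rewrite inE => /eqP->; rewrite leqW ?size_halve.
Qed.

Lemma numeral_replacements s t : numeral s -> t \in replacements s -> numeral t.
Proof.
move=> ns; have s0 := value_gt0 ns; case/(replacementsP _ ns)=> [|[s2]] ->.
  by rewrite numeral_digits ?muln_gt0.
by rewrite numeral_digits // divn_gt0 // dvdn_leq.
Qed.

Definition splits (x : seq nat) : seq (seq nat * seq nat) :=
  [seq (take i x, drop i x) | i <- iota 0 (size x).+1].

Lemma mem_splits x u v : ((u, v) \in splits x) = (x == u ++ v).
Proof.
apply/mapP/eqP => [[i _ [-> ->]]|->]; first by rewrite cat_take_drop.
exists (size u); last by rewrite take_size_cat ?drop_size_cat.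
by rewrite mem_iota size_cat /= ltnS leq_addr.
Qed.

Definition choices (x : seq nat) : seq (seq nat) :=
  let rewrite_after u w :=
    [seq u ++ t ++ sv.2 | sv <- splits w, t <- replacements sv.1] in
  x :: flatten [seq rewrite_after uw.1 uw.2 | uw <- splits x].

Lemma choicesP x y :
  reflect (y = x \/ exists u s v t : seq nat,
             [/\ x = u ++ s ++ v, t \in replacements s & y = u ++ t ++ v])
    (y \in choices x).
Proof.
rewrite inE; apply: (iffP orP) => -[].
- by move/eqP; left.
- case/flatten_mapP=> -[u w]; rewrite mem_splits => /eqP->.
  case/allpairsPdep=> -[s v] [t []]; rewrite mem_splits => /eqP/= -> ts ->.
  by right; exists u, s, v, t.
- by move=> ->; left.
case=> u [s [v [t [-> ts ->]]]]; right; apply/flatten_mapP.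
exists (u, s ++ v); first by rewrite mem_splits.
by apply/allpairsPdep; exists (s, v), t; rewrite mem_splits.
Qed.

Lemma size_choices x y : y \in choices x -> size y <= (size x).+1.
Proof.
case/choicesP=> [->//|[u [s [v [t [-> /size_replacements ts ->]]]]]].
by rewrite !size_cat -addnS leq_add2l -addSn leq_add2r.
Qed.

Lemma numeral_choices x y : numeral x -> y \in choices x -> numeral y.
Proof.
move=> nx /choicesP[->//|[u [s [v [t [E ts ->]]]]]]; rewrite E in nx.
have ns := numeral_infix nx (replacements_head ts).
exact: numeral_subst nx (numeral_replacements ns ts).
Qed.

Lemma choixP n m :
  0 < n -> reflect (choix n m) (digits m \in choices (digits n)).
Proof.
move=> n0; have nn := numeral_digits n0; apply: (iffP idP) => [/choicesP|nm].
  rewrite -[in X in _ -> X](value_digits m).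
  case=> [->|[u [s [v [t [digits_n ts ->]]]]]].
    by rewrite value_digits; exact: choix_id.
  have s0 := replacements_head ts; rewrite digits_n in nn.
  by case/(replacementsP _ (numeral_infix nn s0)): ts => [|[s2]] ->;
    [apply: choix_double | apply: choix_halve].
suff mem_value u s v t : digits n = u ++ s ++ v -> head 0 s != 0 ->
    t = digits (2 * value s) \/ 2 %| value s /\ t = digits (value s %/ 2) ->
    digits (value (u ++ t ++ v)) \in choices (digits n).
  case: nm => [|u s v digits_n s0|u s v digits_n s0 s2]; first exact: mem_head.
    by apply: mem_value digits_n s0 _; left.
  by apply: mem_value digits_n s0 _; right.
move=> digits_n s0 ts; have ns : numeral s.
  by rewrite digits_n in nn; exact: numeral_infix nn s0.
have yn : u ++ t ++ v \in choices (digits n).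
  by apply/choicesP; right; exists u, s, v, t; split=> //; apply/replacementsP.
by rewrite digits_value // (numeral_choices nn yn).
Qed.

Lemma choix_gt0 n m : 0 < n -> choix n m -> 0 < m.
Proof.
move=> n0 /(choixP _ n0)/(numeral_choices (numeral_digits n0)) nm.
by rewrite -(value_digits m) value_gt0.
Qed.

Lemma choix_rcons n m d :
  0 < n -> d < 10 -> choix n m -> choix (n * 10 + d) (m * 10 + d).
Proof.
move=> n0 d10; have digits_nd := digits_rcons n0 d10.
case=> [|u s v digits_n s0|u s v digits_n s0 s2]; first exact: choix_id.
  rewrite -value_rcons !rcons_cat; apply: choix_double => //.
  by rewrite digits_nd digits_n !rcons_cat.
rewrite -value_rcons !rcons_cat; apply: choix_halve => //.
by rewrite digits_nd digits_n !rcons_cat.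
Qed.

(** * Sequences of operations *)

Lemma reaches_in0 m n : reaches_in 0 m n <-> m = n.
Proof. by split=> [[c [<- <-]]|->] //; exists (fun=> n). Qed.

Lemma reaches_inS t m p :
  reaches_in t.+1 m p <-> exists2 n, reaches_in t m n & choix n p.
Proof.
split=> [[c [c0 <- cS]]|[n [c [c0 ct cS]] np]].
  exists (c t); last exact: cS.
  by exists c; split=> // i it; apply: cS; exact: ltnW.
exists (fun i => if i <= t then c i else p); split=> //; first by rewrite ltnn.
move=> i; rewrite ltnS => it; rewrite it.
by case: ltngtP it => // [it|->] _; [exact: cS | rewrite ct].
Qed.

Lemma reaches_in_trans t t' m n p :
  reaches_in t m n -> reaches_in t' n p -> reaches_in (t + t') m p.
Proof.
move=> mn; elim: t' p => [|t' IH] p.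
  by move/reaches_in0 <-; rewrite addn0.
case/reaches_inS=> q nq qp; rewrite addnS; apply/reaches_inS.
by exists q => //; exact: IH.
Qed.

Lemma reaches_in_gt0 t m n : 0 < m -> reaches_in t m n -> 0 < n.
Proof.
move=> m0; elim: t n => [|t IH] n; first by move/reaches_in0 <-.
by case/reaches_inS=> p /IH p0; apply: choix_gt0.
Qed.

Lemma reaches_in_size t m n :
  0 < m -> reaches_in t m n -> size (digits n) <= size (digits m) + t.
Proof.
move=> m0; elim: t n => [|t IH] n; first by move/reaches_in0 <-; rewrite addn0.
case/reaches_inS=> p mp /(choixP _ (reaches_in_gt0 m0 mp))/size_choices pn.
by rewrite addnS; apply: leq_trans pn _; rewrite ltnS IH.
Qed.

Lemma reaches_in_rcons t m n d :
  0 < m -> d < 10 -> reaches_in t m n -> reaches_in t (m * 10 + d) (n * 10 + d).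
Proof.
move=> m0 d10; elim: t n => [|t IH] n.
  by move/reaches_in0 ->; apply/reaches_in0.
case/reaches_inS=> p mp pn; apply/reaches_inS.
exists (p * 10 + d); first exact: IH.
exact: choix_rcons (reaches_in_gt0 m0 mp) d10 pn.
Qed.

Fixpoint search (p : nat -> pred (seq nat)) (t : nat) (x : seq nat) :
  seq (seq nat) :=
  if t is t'.+1 then
    undup [seq y <- flatten (map choices (search p t' x)) | p t y]
  else [:: x].

Lemma search_nextP p t x y :
  reflect (exists2 z, z \in search p t x & y \in choices z /\ p t.+1 y)
    (y \in search p t.+1 x).
Proof.
rewrite mem_undup mem_filter; apply: (iffP andP) => [[py /flatten_mapP[z]]|].
  by exists z.
by case=> z zx [yz py]; split=> //; apply/flatten_mapP; exists z.
Qed.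

Lemma numeral_search p t x y : numeral x -> y \in search p t x -> numeral y.
Proof.
move=> nx; elim: t y => [|t IH] y; first by rewrite inE => /eqP->.
by case/search_nextP=> z /IH nz [/(numeral_choices nz)].
Qed.

Lemma search_reaches_in p t m n :
  0 < m -> digits n \in search p t (digits m) -> reaches_in t m n.
Proof.
move=> m0; elim: t n => [|t IH] n.
  by rewrite inE => /eqP/(can_inj value_digits) ->; apply/reaches_in0.
case/search_nextP=> z zm [nz _]; apply/reaches_inS.
have numz := numeral_search (numeral_digits m0) zm.
exists (value z); first by apply: IH; rewrite digits_value.
by apply/choixP; rewrite ?value_gt0 ?digits_value.
Qed.

Lemma reaches_in_search (p : nat -> pred (seq nat)) t m n :
  (forall i x y, y \in choices x -> p i.+1 y -> p i x) ->
  0 < m -> reaches_in t m n -> p t (digits n) ->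
  digits n \in search p t (digits m).
Proof.
move=> p_back m0; elim: t n => [|t IH] n.
  by move/reaches_in0 ->; rewrite mem_head.
case/reaches_inS=> k mk /(choixP _ (reaches_in_gt0 m0 mk)) kn pn.
apply/search_nextP; exists (digits k) => //.
exact: IH mk (p_back _ _ _ kn pn).
Qed.

Lemma search_nil p t k x : search p t x = [::] -> search p (t + k) x = [::].
Proof. by move=> t0; elim: k => [|k IH]; rewrite ?addn0 // addnS /= IH. Qed.

(** * The upper bound *)

(* No operation changes whether 5 divides a number. *)
Definition seed (n : nat) : nat := if 5 %| n then 5 else 1.

Lemma seed_small n : 0 < seed n < 10.
Proof. by rewrite /seed; case: ifP. Qed.

Lemma seed_rcons n d : seed (n * 10 + d) = seed d.
Proof. by rewrite /seed dvdn_addr // dvdn_mull. Qed.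

Lemma search_two_digits r : r \in [:: 1; 5] ->
  let found := search (fun=> [pred x | size x <= 3]) 12 [:: r] in
  all (fun n => (seed n == r) ==> (digits n \in found)) (iota 10 90).
Proof. by rewrite !inE => /orP[] /eqP->; vm_compute. Qed.

Lemma seed_reaches_two_digits n : 10 <= n < 100 -> reaches_in 12 (seed n) n.
Proof.
move=> n2; have /andP[r0 r10] := seed_small n.
have r15 : seed n \in [:: 1; 5] by rewrite /seed; case: ifP.
have := allP (search_two_digits r15) n.
rewrite mem_iota eqxx -(digits_small r10).
by move/(_ n2); apply: search_reaches_in.
Qed.

Lemma seed_reaches n : 10 <= n -> reaches_in (12 * trunc_log 10 n) (seed n) n.
Proof.
move=> n10; have n0 := leq_trans (isT : 0 < 10) n10; move: n n0 n10.
apply: decimal_ind => [n /andP[_ n10]|m d m0 d10 IH _].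
  by rewrite leqNgt n10.
rewrite trunc_log10_rcons //; have [m10|m10] := ltnP m 10.
  have -> : trunc_log 10 m = 0 by apply/eqP; rewrite trunc_log_eq0.
  by apply: seed_reaches_two_digits; lia.
have /andP[r0 r10] := seed_small m.
have unfold_seed : reaches_in 12 (seed (m * 10 + d)) (seed m * 10 + d).
  rewrite seed_rcons -(seed_rcons (seed m)).
  by apply: seed_reaches_two_digits; lia.
rewrite mulnS; apply: reaches_in_trans unfold_seed _.
exact: reaches_in_rcons r0 d10 (IH m10).
Qed.

Lemma reaches_from1 n : 10 <= n ->
  last 0 (digits n) != 0 -> last 0 (digits n) != 5 ->
  reaches_in (12 * trunc_log 10 n) 1 n.
Proof.
rewrite last_digits => /seed_reaches.
rewrite /seed; case: ifP => // n5 _ n0 nn5.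
by exfalso; lia.
Qed.

(** * The lower bound *)

Definition tight (e t : nat) : pred (seq nat) := [pred x | t < size x + e].

Lemma tight_choices e t x y : y \in choices x -> tight e t.+1 y -> tight e t x.
Proof.
move=> /size_choices yx ty; rewrite /tight /= -ltnS -addSn.
by apply: leq_trans ty _; rewrite leq_add2r.
Qed.

Lemma tight_search_nil_leq e T t m n :
  0 < m -> search (tight e) T (digits m) = [::] ->
  size (digits m) + T <= size (digits n) ->
  reaches_in t m n -> size (digits n) + e <= t.
Proof.
move=> m0 dead long mn; rewrite leqNgt; apply/negP => tight_n.
have := reaches_in_search (@tight_choices e) m0 mn tight_n.
have Tt : T <= t.
  by rewrite -(leq_add2l (size (digits m))) (leq_trans long) ?reaches_in_size.
by rewrite -(subnKC Tt) search_nil.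
Qed.

Lemma search_tight5 : search (tight 5) 10 [:: 1] = [::].
Proof. by vm_compute. Qed.

Lemma reaches_from1_leq t n :
  10 <= trunc_log 10 n -> reaches_in t 1 n -> trunc_log 10 n + 6 <= t.
Proof.
move=> log_n tn; have digits_1 : digits 1 = [:: 1] by apply: digits_small.
have dead : search (tight 5) 10 (digits 1) = [::].
  by rewrite digits_1 search_tight5.
rewrite addnS -addSn -size_digits.
apply: (tight_search_nil_leq (isT : 0 < 1) dead _ tn).
by rewrite digits_1 size_digits.
Qed.

(** * The bounds on [tau] *)

Lemma least_ops_tau t n : reaches_in t 1 n -> least_ops n (tau n).
Proof.
move=> tn; apply: (xgetPex 0).
have ex : exists i, `[< reaches_in i 1 n >] by exists t; apply/asboolP.
case: (ex_minnP ex) => m /asboolP mn mmin; exists m; split=> // k kn.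
by apply: mmin; apply/asboolP.
Qed.

Import Order.TTheory GRing.Theory Num.Theory.
Local Open Scope ring_scope.

Lemma log10_bounds (R : realType) n : (0 < n)%N ->
  (trunc_log 10 n)%:R <= log10 (n%:R : R) < (trunc_log 10 n).+1%:R.
Proof.
move=> n0; have ln10 : 0 < ln (10 : R) by rewrite ln_gt0 // ltr1n.
have /andP[lo hi] := trunc_log_bounds (isT : (1 < 10)%N) n0.
rewrite /log10 ler_pdivlMr // ltr_pdivrMr // !mulr_natl -!lnXn ?ltr0n //.
rewrite -!natrX ler_ln ?ltr_ln ?posrE ?ltr0n ?expn_gt0 //.
by rewrite ler_nat ltr_nat lo.
Qed.

Theorem theorem7 (R : realType) :
  exists N : nat, forall n : nat, (N <= n)%N ->
    last 0%N (digits n) != 0%N -> last 0%N (digits n) != 5%N ->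
    (log10 (n%:R : R) + 5 < (tau n)%:R <= 12 * log10 (n%:R : R))%R.
Proof.
exists (10 ^ 10)%N => n /(trunc_log_max (isT : 1 < 10)%N) log_n l0 l5.
have n10 : (10 <= n)%N.
  by have := leq_trans (isT : 0 < 10)%N log_n; rewrite trunc_log_gt0.
have up := reaches_from1 n10 l0 l5.
have [tn tmin] := least_ops_tau up.
have /andP[lo hi] := log10_bounds R (leq_trans (isT : 0 < 10)%N n10).
apply/andP; split.
  have := reaches_from1_leq log_n tn; rewrite -(ler_nat R); apply: lt_le_trans.
  by rewrite addnS -addSn natrD ltrD2r.
apply: (@le_trans _ _ (12 * trunc_log 10 n)%N%:R).
  by rewrite ler_nat tmin.
by rewrite natrM ler_pM2l ?ltr0n.
Qed.
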